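(* For every positive integer $e$ and every positive divisor $d$ of $e$, the path $P_{e+1}$ on $e+1$ vertices admits a $d$-graceful $\alpha$-labeling.
   Context: For a graph $\Gamma$ of size $e$ and a divisor $d$ of $e$ with $e=d\cdot m$, a $d$-graceful labeling of $\Gamma$ is an injective function $f:V(\Gamma)\to\{0,1,\ldots,d(m+1)-1\}$ such that $\{|f(x)-f(y)| : [x,y]\in E(\Gamma)\}=\{1,2,\ldots,d(m+1)-1\}\setminus\{m+1,2(m+1),\ldots,(d-1)(m+1)\}$. If $\Gamma$ is bipartite with parts $X,Y$, a $d$-graceful $\alpha$-labeling is a $d$-graceful labeling $f$ such that $\max f(X)<\min f(Y)$ for a suitable ordering of the two parts. The path $P_{e+1}$ has $e+1$ vertices and $e$ edges. *)

(* Defs.v *)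
From HB Require Import structures.
From mathcomp Require Import all_boot all_order all_algebra.
Set Implicit Arguments. Unset Strict Implicit. Unset Printing Implicit Defensive.

Record sgraph := SGraph {
  vertex :> finType;
  adj : rel vertex;
  adj_sym : symmetric adj;
  adj_irr : irreflexive adj }.

Definition edges (G : sgraph) : {set {set G}} :=
  [set [set x; y] | x in [set: G], y in [set: G] & adj x y].

Definition gsize (G : sgraph) : nat := #|edges G|.

(* The set equality quantifies over ordered pairs of adjacent vertices, which
   is harmless as adj is symmetric; `|f x - f y|%N is the distance in nat. *)
Definition d_graceful_labeling (G : sgraph) (d : nat) (f : G -> nat) : Prop :=
  exists m : nat,
    [/\ 0 < d /\ gsize G = d * m,
        injective f,
        forall x, f x <= d * m.+1 - 1
      & forall k : nat,
          (exists x y : G, adj x y /\ `|f x - f y|%N = k) <->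
          (1 <= k <= d * m.+1 - 1 /\
           ~ (exists i : nat, 1 <= i <= d - 1 /\ k = i * m.+1))].

Definition bipartition (G : sgraph) (X Y : {set G}) : Prop :=
  [/\ X :|: Y = [set: G],
      [disjoint X & Y]
    & forall x y : G, adj x y ->
        (x \in X) && (y \in Y) || (x \in Y) && (y \in X)].

(* Quantifying over the ordered pair (X, Y) accounts for the choice of an
   ordering of the two parts. *)
Definition d_graceful_alpha_labeling (G : sgraph) (d : nat) (f : G -> nat) :
    Prop :=
  d_graceful_labeling d f /\
  exists X Y : {set G}, bipartition X Y /\
    (forall x y : G, x \in X -> y \in Y -> f x < f y).

Definition path_adj (n : nat) : rel 'I_n :=
  fun i j => (i.+1 == j :> nat) || (j.+1 == i :> nat).

Lemma path_adj_sym n : symmetric (@path_adj n).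
Proof. by move=> i j; rewrite /path_adj orbC. Qed.

Lemma path_adj_irr n : irreflexive (@path_adj n).
Proof. by move=> i; rewrite /path_adj orbb eqn_leq ltnn. Qed.

Definition path_graph (n : nat) : sgraph :=
  SGraph (@path_adj_sym n) (@path_adj_irr n).

Lemma gsize_path (e : nat) : gsize (path_graph e.+1) = e.
Proof.
pose g (i : 'I_e) : {set 'I_e.+1} :=
  [set widen_ord (leqnSn e) i; lift ord0 i].
have g_inj : injective g.
  move=> i j gij; apply/val_inj/eqP; rewrite eqn_leq.
  have key (a b : 'I_e) : g a = g b -> b <= a.
    move=> gab; have: widen_ord (leqnSn e) a \in g b by rewrite -gab !inE eqxx.
    rewrite !inE => /orP[]/eqP/(congr1 val) /=; first by move->.
    by rewrite /bump /= => ->; rewrite leq_addl.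
  by rewrite (key _ _ gij) (key _ _ (esym gij)).
rewrite -[RHS]card_ord -(card_codom g_inj) /gsize.
apply: eq_card => A; apply/imset2P/codomP => [[x y _]|[i ->]].
  rewrite !inE /= => /orP[/eqP xy|/eqP xy] ->.
    have xe : x < e by rewrite -ltnS xy ltn_ord.
    exists (Ordinal xe); rewrite /g; congr [set _; _]; apply: val_inj => //=.
  have ye : y < e by rewrite -ltnS xy ltn_ord.
  exists (Ordinal ye); rewrite /g setUC; congr [set _; _]; apply: val_inj => //=.
exists (widen_ord (leqnSn e) i) (lift ord0 i) => //.
by rewrite !inE /= /path_adj /= eqxx.
Qed.

(* Main.v *)
Require Import Defs.
From mathcomp Require Import all_boot all_order all_algebra.
From mathcomp Require Import zify.

(** Any strictly decreasing sequence D 0 > D 1 > ... > D (e-1) > 0 is the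
    sequence of edge differences of the zigzag labeling
    0, D 0, D 0 - D 1, D 0 - D 1 + D 2, ... of the path; its labels increase
    along the even vertices, decrease along the odd ones, and each even label
    lies below each odd one.  It remains to list the prescribed differences in
    decreasing order. *)

(* The reflection x |-> D 0 - x turns the labeling for D, deprived of its first
   vertex, into the labeling for the shifted sequence; this makes every
   property below a direct induction. *)
Fixpoint zigzag (D : nat -> nat) (n : nat) : nat :=
  if n is n'.+1 then D 0 - zigzag (fun i => D i.+1) n' else 0.

Lemma zigzag_le D n : zigzag D n <= D 0.
Proof. by case: n => //= n; rewrite leq_subr. Qed.

Lemma zigzag_gt0 D n : D 1 < D 0 -> 0 < zigzag D n.+1.
Proof. by have /= := zigzag_le (fun i => D i.+1) n; lia. Qed.

Lemma zigzag_dist e D n : (forall i, i < e -> D i.+1 < D i) -> n < e ->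
  `|zigzag D n - zigzag D n.+1|%N = D n.
Proof.
elim: n e D => [|n IHn] [|e] D decD //= ltne; first by lia.
have := IHn e (fun i => D i.+1) (fun i => decD i.+1) ltne.
have := zigzag_le (fun i => D i.+1) n.
have := zigzag_le (fun i => D i.+1) n.+1.
have := decD 0 isT; rewrite /=; lia.
Qed.

Lemma zigzag_inj e D a b : (forall i, i < e -> D i.+1 < D i) ->
  a <= e -> b <= e -> zigzag D a = zigzag D b -> a = b.
Proof.
elim: a e D b => [|a IHa] [|e] D [|b] decD // leae lebe eqab.
- by have := zigzag_gt0 D b (decD 0 isT); rewrite -eqab.
- by have := zigzag_gt0 D a (decD 0 isT); rewrite eqab.
congr _.+1; apply: (IHa e (fun i => D i.+1)) => // [i|]; first exact: (decD i.+1).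
move: eqab (zigzag_le (fun i => D i.+1) a) (zigzag_le (fun i => D i.+1) b).
by have := decD 0 isT; rewrite /=; lia.
Qed.

(** The reflection shifts both indices by one, so it exchanges the parities while reversing the
    order. The roles of [a] and [b] thus swap, hence the induction on [a + b]. *)
Lemma zigzag_even_lt_odd e D a b : (forall i, i < e -> D i.+1 < D i) ->
  a <= e -> b <= e -> ~~ odd a -> odd b -> zigzag D a < zigzag D b.
Proof.
have [n] := ubnP (a + b); elim: n e D a b => [|n IHn] // [|e] D [|a] [|b] //=.
  by move=> _ decD *; exact: (zigzag_gt0 D b (decD 0 isT)).
move=> ltn decD leae lebe; rewrite negbK => oda evb.
have: zigzag (fun i => D i.+1) b < zigzag (fun i => D i.+1) a.
  by apply: (IHn e) => // [|i]; [lia | exact: (decD i.+1)].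
move: (zigzag_le (fun i => D i.+1) a) (zigzag_le (fun i => D i.+1) b).
by have := decD 0 isT; lia.
Qed.

(* The i-th largest element, counted from 0, of {1, ..., d(m+1)-1} without the
   multiples of m+1; for i = d m the truncated subtraction gives 0. *)
Definition graceful_diff (d m i : nat) : nat := d * m.+1 - 1 - i - i %/ m.

(** The list splits into [d] blocks of [m] consecutive integers, block [q] lying strictly between
    [(d - q - 1) * m.+1] and [(d - q) * m.+1]. *)
Lemma graceful_diff_divn_eq d m q r : r < m ->
  graceful_diff d m (q * m + r) = d * m.+1 - (q * m.+1 + r.+1).
Proof.
move=> ltrm; rewrite /graceful_diff divnMDl ?(leq_trans _ ltrm) //.
by rewrite divn_small // addn0 mulnSr; lia.
Qed.

Lemma graceful_diff_decreasing d m i : i < d * m ->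
  graceful_diff d m i.+1 < graceful_diff d m i.
Proof.
move=> ltie; have m_gt0 : 0 < m by case: m ltie; rewrite // muln0.
have ltqd : i %/ m < d by rewrite ltn_divLR.
have := leq_div2r m (leqnSn i).
rewrite /graceful_diff; nia.
Qed.

Lemma graceful_diffP d m k : 0 < m ->
  (exists2 i, i < d * m & graceful_diff d m i = k) <->
  (1 <= k <= d * m.+1 - 1 /\
   ~ (exists i : nat, 1 <= i <= d - 1 /\ k = i * m.+1)).
Proof.
move=> m_gt0; split=> [[i ltie <-]|[/andP[k_gt0 lek] Nk]].
  have ltqd : i %/ m < d by rewrite ltn_divLR.
  have ltrm : i %% m < m by rewrite ltn_mod.
  rewrite (divn_eq i m) graceful_diff_divn_eq //.
  move: (i %/ m) (i %% m) ltqd ltrm => q r ltqd ltrm; split; first by nia.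
  case=> t [_ eqt].
  (* No multiple of [m.+1] equals [r.+1], since [0 < r.+1 <= m]. *)
  have : (d - q - t) * m.+1 = r.+1 by rewrite !mulnBl -eqt; nia.
  by case: (d - q - t) => [|s] //; nia.
(* The rank of [k] from the top of the full interval: division by [m.+1] gives its block [q] and
   offset [r], and offset [m] would make [k] a multiple of [m.+1]. *)
pose j := d * m.+1 - 1 - k.
have eqj := divn_eq j m.+1; have ltrm : j %% m.+1 < m.+1 by rewrite ltn_mod.
move: (j %/ m.+1) (j %% m.+1) eqj ltrm => q r eqj; rewrite ltnS leq_eqVlt.
have eqk : k + (q * m.+1 + r.+1) = d * m.+1 by rewrite addnS -eqj /j; lia.
have ltqd : q < d by rewrite -(@ltn_pmul2r m.+1) //; lia.
case/predU1P=> [rm|ltrm].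
  case: Nk; exists (d - q.+1); rewrite mulnBl.
  have eqk' : k + q.+1 * m.+1 = d * m.+1 by rewrite -eqk rm mulSn; lia.
  split; last by lia.
  have : q.+1 * m.+1 < d * m.+1 by lia.
  by rewrite ltn_pmul2r //; lia.
exists (q * m + r); first by nia.
by rewrite graceful_diff_divn_eq //; lia.
Qed.

Theorem theorem3p1 (e d : nat) (he : 0 < e) (hd : 0 < d) (hde : d %| e) :
  exists f : path_graph e.+1 -> nat, d_graceful_alpha_labeling d f.
Proof.
case/dvdnP: hde => m; rewrite mulnC => def_e.
have m_gt0 : 0 < m by move: he; rewrite def_e muln_gt0 => /andP[].
pose D := graceful_diff d m.
(* At [i = e - 1], where [D e = 0], this says that the last difference is positive. *)
have decD i : i < e -> D i.+1 < D i.
  by rewrite def_e; exact: graceful_diff_decreasing.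
have le_e (x : path_graph e.+1) : (x : 'I_e.+1) <= e := leq_ord x.
exists (fun x : 'I_e.+1 => zigzag D x); split.
  exists m; split; first by rewrite gsize_path.
  - by move=> x y /(zigzag_inj e D x y decD (le_e x) (le_e y))/val_inj.
  - move=> x; apply: leq_trans (zigzag_le _ _) _.
    by rewrite /D /graceful_diff div0n !subn0.
  move=> k; rewrite -graceful_diffP // -def_e; split=> [[x [y [xy <-]]]|].
    case/orP: xy => /eqP eqxy.
      have ltxe : x < e by rewrite -ltnS eqxy.
      by exists x; rewrite // -eqxy (zigzag_dist e).
    have ltye : y < e by rewrite -ltnS eqxy.
    by exists y; rewrite // -eqxy distnC (zigzag_dist e).
  case=> i ltie <-; exists (inord i), (inord i.+1).
  have lti : i < e.+1 by exact: ltnW.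
  by rewrite /= /path_adj !inordK // eqxx (zigzag_dist e).
exists [set x : 'I_e.+1 | ~~ odd x], [set x : 'I_e.+1 | odd x]; split; last first.
  by move=> x y; rewrite !inE; apply: (zigzag_even_lt_odd e).
split.
- by apply/setP=> x; rewrite !inE orNb.
- by rewrite disjoints_subset; apply/subsetP=> x; rewrite !inE.
move=> x y; rewrite !inE => /orP[]/eqP <- /=; by case: (odd _).
Qed.
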